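(* Let $G$ be the group of all finite permutations of $\mathbb N=\{1,2,\dots\}$, i.e. bijections $g:\mathbb N\to\mathbb N$ moving only finitely many elements, with multiplication $gh=h\circ g$. For every $k\ge2$, the set $$C_k^{\mathsf{incr}}=\{g\in G:\ g(1)<g(2)<\cdots<g(k)\}$$ is strongly deterministic in $G$, and it has positive Banach density $\frac1{k!}$.
   Context: A F\o lner sequence in $G$ is a sequence $\mathcal F=(F_n)$ of nonempty finite subsets of $G$ such that for every nonempty finite $K\subset G$ and $\varepsilon>0$, $|KF_n\triangle F_n|/|F_n|\le\varepsilon$ for all but finitely many $n$ ($G$ is amenable, so these exist). The upper and lower Banach densities of $A\subset G$ are $d^*(A)=\sup_{\mathcal F}\limsup_n\frac{|F_n\cap A|}{|F_n|}$ and $d_*(A)=\inf_{\mathcal F}\liminf_n\frac{|F_n\cap A|}{|F_n|}$, where $\mathcal F$ ranges over all F\o lner sequences; if they coincide the common value is the Banach density of $A$. A dynamical system $(X,G)$ is an action of $G$ by continuous maps on a compact metric space $X$ (with $(gh)(x)=g(h(x))$). For an invariant Borel probability measure $\mu$ its entropy is $h(\mu)=\sup_{\mathcal P}\lim_n\frac1{|F_n|}H\big(\mu,\bigvee_{g\in F_n}g^{-1}(\mathcal P)\big)$ ($\mathcal P$ over finite measurable partitions, $H$ Shannon entropy; independent of the F\o lner sequence), and the topological entropy of $(X,G)$ is $\sup_\mu h(\mu)$ over invariant measures. A set $A\subset G$ is strongly deterministic if there are a dynamical system $(X,G)$ of topological entropy zero, a continuous $\varphi:X\to\mathbb R$ and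 $x\in X$ with $\mathbf 1_A(g)=\varphi(g(x))$ for all $g\in G$. *)

(* Defs.v *)
From HB Require Import structures.
From mathcomp Require Import all_boot all_order all_algebra finmap.
From mathcomp Require Import all_classical all_reals all_analysis.

Set Implicit Arguments.
Unset Strict Implicit.
Unset Printing Implicit Defensive.

Import Order.TTheory GRing.Theory Num.Theory.
Import numFieldNormedType.Exports.

Local Open Scope classical_set_scope.
Local Open Scope ring_scope.
Local Open Scope fset_scope.

Section BanachDensity.
Context (R : realType) (G : groupType).

Definition fset_symdiff (A B : {fset G}) : {fset G} :=
  (A `\` B) `|` (B `\` A).

Definition fset_prod (K F : {fset G}) : {fset G} :=
  [fset (p.1 * p.2)%g | p in K `*` F].

Definition folner (F : nat -> {fset G}) : Prop :=
  (forall n, F n != fset0) /\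
  forall (K : {fset G}) (eps : R), K != fset0 -> 0 < eps ->
    \forall n \near \oo,
      #|` fset_symdiff (fset_prod K (F n)) (F n)|%:R / #|` F n|%:R <= eps.

Definition density_in (A : set G) (F : {fset G}) : R :=
  #|` [fset g in F | g \in A]|%:R / #|` F|%:R.

Definition upper_banach_density (A : set G) : \bar R :=
  ereal_sup [set limn_esup (fun n => (density_in A (F n))%:E) | F in folner].

Definition lower_banach_density (A : set G) : \bar R :=
  ereal_inf [set limn_einf (fun n => (density_in A (F n))%:E) | F in folner].

Definition has_banach_density (A : set G) (d : R) : Prop :=
  upper_banach_density A = d%:E /\ lower_banach_density A = d%:E.

End BanachDensity.

(* The base point of [pmetricType] only records that the space is nonempty:
   the library requires it to equip a type with a sigma-algebra. *)
#[short(type="pmetricType")]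
HB.structure Definition PointedMetric (R : numDomainType) :=
  {M of Metric R M & Pointed M}.

Notation borel X := (g_sigma_algebraType (@open X)).

Section Entropy.
Context (R : realType) (G : groupType) (X : pmetricType R).
Implicit Types (mu : probability (borel X) R) (act : G -> X -> X).

Definition dynamical_system act : Prop :=
  [/\ compact [set: X],
      forall g, continuous (act g),
      forall x, act 1%g x = x &
      forall g h x, act (g * h)%g x = act g (act h x)].

Definition invariant_measure act mu : Prop :=
  forall (g : G) (A : set (borel X)), measurable A ->
    mu (act g @^-1` A) = mu A.

Definition measurable_partition (m : nat) (P : 'I_m -> set (borel X)) : Prop :=
  partition [set: 'I_m] P [set: X] /\ forall i, measurable (P i).

(* The join of the g^-1(P), g in F: one cell for each map from F to the index
   set of P. Cells may be empty; since [ln 0 = 0], an empty cell does not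
   contribute to the Shannon entropy. *)
Definition join_cell act (F : {fset G}) (m : nat) (P : 'I_m -> set (borel X))
    (c : {ffun F -> 'I_m}) : set (borel X) :=
  \bigcap_(g in [set: F]) (act (fsval g) @^-1` P (c g)).

Definition shannon_entropy mu (I : finType) (P : I -> set (borel X)) : R :=
  - \sum_(i : I) fine (mu (P i)) * ln (fine (mu (P i))).

(* For an invariant [mu] and a Folner sequence [F] the sequence converges
   (Ornstein-Weiss), so the upper limit is its limit; unlike [limn] it has no
   junk value. *)
Definition partition_entropy act (F : nat -> {fset G}) mu
    (m : nat) (P : 'I_m -> set (borel X)) : \bar R :=
  limn_esup (fun n =>
    (shannon_entropy mu (@join_cell act (F n) m P) / #|` F n|%:R)%:E).

Definition measure_entropy act (F : nat -> {fset G}) mu : \bar R :=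
  ereal_sup [set e | exists (m : nat) (P : 'I_m -> set (borel X)),
    measurable_partition P /\ e = partition_entropy act F mu P].

Definition topological_entropy act (F : nat -> {fset G}) : \bar R :=
  ereal_sup [set measure_entropy act F mu | mu in invariant_measure act].

End Entropy.

(* Entropy does not depend on the Folner sequence, so it is required to vanish
   along each of them. Meant for amenable [G], where Folner sequences exist. *)
Definition strongly_deterministic (R : realType) (G : groupType) (A : set G)
    : Prop :=
  exists (X : pmetricType R) (act : G -> X -> X) (phi : X -> R) (x : X),
    [/\ dynamical_system act,
        forall F, folner R F -> topological_entropy act F = 0%E,
        continuous phi &
        forall g, \1_A g = phi (act g x)].

Section FinitaryPermutations.
Context (T : Type).

Record fperm := FPerm {
  fperm_fun :> T -> T;
  fperm_bij : bijective fperm_fun;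
  fperm_fin : finite_set [set x | fperm_fun x <> x] }.

HB.instance Definition _ := gen_eqMixin fperm.
HB.instance Definition _ := gen_choiceMixin fperm.

Lemma fpermP (g h : fperm) : g =1 h -> g = h.
Proof.
case: g h => [g gb gf] [h hb hf] /= /funext gh; subst h.
by congr FPerm; exact: Prop_irrelevance.
Qed.

Lemma fperm_inv_subproof (g : fperm) : exists f, cancel g f /\ cancel f g.
Proof. by have [f gf fg] := fperm_bij g; exists f. Qed.

Definition fperm_inv_fun (g : fperm) : T -> T :=
  sval (cid (fperm_inv_subproof g)).

Lemma fperm_invK (g : fperm) : cancel g (fperm_inv_fun g).
Proof. by rewrite /fperm_inv_fun; case: cid => f []. Qed.

Lemma fperm_invVK (g : fperm) : cancel (fperm_inv_fun g) g.
Proof. by rewrite /fperm_inv_fun; case: cid => f []. Qed.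

Lemma fperm_one_fin : finite_set [set x : T | id x <> x].
Proof. by apply: (sub_finite_set _ (finite_set0 T)) => x. Qed.

Definition fperm_one : fperm := FPerm (@inv_bij _ id (frefl _)) fperm_one_fin.

Lemma fperm_mul_fin (g h : fperm) : finite_set [set x | (h \o g) x <> x].
Proof.
have gh : finite_set ([set x | g x <> x] `|` [set x | h x <> x])%classic.
  by rewrite finite_setU; split; exact: fperm_fin.
apply: (sub_finite_set _ gh) => x /= hgx.
have [gx|gx] := pselect (g x = x); last by left.
by right => hx; apply: hgx; rewrite gx.
Qed.

Definition fperm_mul (g h : fperm) : fperm :=
  FPerm (bij_comp (fperm_bij h) (fperm_bij g)) (fperm_mul_fin g h).

Lemma fperm_inv_fin (g : fperm) : finite_set [set x | fperm_inv_fun g x <> x].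
Proof.
apply: (sub_finite_set _ (fperm_fin g)) => x /= gx xg; apply: gx.
by rewrite -{1}xg fperm_invK.
Qed.

Definition fperm_inv (g : fperm) : fperm :=
  FPerm (Bijective (fperm_invVK g) (fperm_invK g)) (fperm_inv_fin g).

Fact fperm_mulA : associative fperm_mul.
Proof. by move=> g h f; apply: fpermP. Qed.

Fact fperm_mul1 : left_id fperm_one fperm_mul.
Proof. by move=> g; apply: fpermP. Qed.

Fact fperm_mulr1 : right_id fperm_one fperm_mul.
Proof. by move=> g; apply: fpermP. Qed.

Fact fperm_mulV : left_inverse fperm_one fperm_inv fperm_mul.
Proof. by move=> g; apply: fpermP => x; exact: fperm_invVK. Qed.

Fact fperm_mulrV : right_inverse fperm_one fperm_inv fperm_mul.
Proof. by move=> g; apply: fpermP => x; exact: fperm_invK. Qed.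

HB.instance Definition _ := isGroup.Build fperm fperm_mulA
  fperm_mul1 fperm_mulr1 fperm_mulV fperm_mulrV.

Lemma fperm_mulE (g h : fperm) x : (g * h)%g x = h (g x).
Proof. by []. Qed.

End FinitaryPermutations.

Definition posnat := {n : nat | (0 < n)%N}.

Definition C_incr (k : nat) : set (fperm posnat) :=
  [set g | forall i j : posnat,
    (val i < val j)%N -> (val j <= k)%N -> (val (g i) < val (g j))%N].

(* Main.v *)
Require Import Defs.
From HB Require Import structures.
From mathcomp Require Import all_boot all_order all_algebra perm finmap.
From mathcomp Require Import all_classical all_reals all_analysis.

Set Implicit Arguments.
Unset Strict Implicit.
Unset Printing Implicit Defensive.

Import Order.TTheory GRing.Theory Num.Theory.
Import numFieldNormedType.Exports.

Local Open Scope classical_set_scope.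
Local Open Scope ring_scope.

(** Following g(1) < ... < g(k) along G amounts to following a single relation.
    Let G act on all binary relations x on the positive integers by
      (g x) i j = x (g i) (g j),
    a left action because the product is gh = h o g. For x the usual order and
    phi the indicator of x i j for all i < j <= k, phi (g x) is the indicator
    of g(1) < ... < g(k). The relations form a compact metric space, and phi is
    continuous since it looks at finitely many entries of x.

    This action has entropy zero, even on the space of all relations. If a
    partition depends only on the entries of x at the places in
    {1, ..., n} ^ 2, then its translate by g depends only on the restriction of
    g to {1, ..., n}. A Folner set F sees very few restrictions compared with
    its size: when K is a large finite set of permutations fixing 1, ..., n,
    all of K g restricts like g, so the number of restrictions times |K| is at
    most |K F| <= 2 |F| ([card_classes_mul], [folner_card_prod]). Any Borel
    partition P is, up to a set of small measure, one of these partitions Q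
    ([borel_approximable], [finite_partition_approximation]), and P is
    recovered from Q and from the correction D, which takes one fixed value
    where Q is right. The entropy of D is small ([entropy_heavy_cell]), so by
    subadditivity and invariance the itineraries of P along F have entropy at most a
    small multiple of |F| ([itinerary_entropy]). Thus every invariant measure
    has entropy zero. The supremum of these entropies is 0 and not that of
    the empty set, because the point mass at the empty relation is invariant.

    For the density, let Sym k be the group of permutations of {1, ..., k}.
    Exactly one h in Sym k makes h g increasing on {1, ..., k}
    ([C_incr_tile]), so the k! sets {g in F | h g in C_k} partition F; when F is
    almost invariant under Sym k they have almost the same cardinality
    ([tiling_density]). So the density along each Folner sequence is 1 / k!, and
    n |-> Sym n is such a sequence ([folner_Sym]). *)

(** * Entropy of finite-valued maps *)

Section FiniteEntropy.
Context d (T : measurableType d) (R : realType) (mu : probability T R).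

Definition prob (A : set T) : R := fine (mu A).

Definition entropy (I : finType) (f : T -> I) : R :=
  - \sum_(i : I) prob (f @^-1` [set i]) * ln (prob (f @^-1` [set i])).

Definition measurable_fibers (I : finType) (f : T -> I) : Prop :=
  forall i, measurable (f @^-1` [set i]).

Lemma prob_ge0 A : 0 <= prob A.
Proof. exact: fine_ge0. Qed.

Lemma prob_EFin A : measurable A -> (prob A)%:E = mu A.
Proof. by move=> mA; rewrite /prob fineK// fin_num_measure. Qed.

Lemma prob_le1 A : measurable A -> prob A <= 1.
Proof. by move=> mA; rewrite -lee_fin prob_EFin// probability_le1. Qed.

Lemma le_prob A B : measurable A -> measurable B -> A `<=` B ->
  prob A <= prob B.
Proof.
by move=> mA mB AB; rewrite -lee_fin !prob_EFin// le_measure ?inE.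
Qed.

Lemma probT : prob setT = 1.
Proof. by rewrite /prob probability_setT. Qed.

Lemma prob0 : prob set0 = 0.
Proof. by rewrite /prob measure0. Qed.

Lemma preimage_fin_bigcup (I : finType) (f : T -> I) (B : {pred I}) :
  [set x | f x \in B] = \bigcup_(i in [set i | i \in B]) (f @^-1` [set i]).
Proof.
by apply/seteqP; split => [x Bfx|x [i /= Bi ->]]; first by exists (f x).
Qed.

Lemma measurable_preimage (I : finType) (f : T -> I) (B : {pred I}) :
  measurable_fibers f -> measurable [set x | f x \in B].
Proof.
by move=> mf; rewrite preimage_fin_bigcup; exact: fin_bigcup_measurable.
Qed.

Lemma prob_preimage (I : finType) (f : T -> I) (B : {pred I}) :
  measurable_fibers f ->
  prob [set x | f x \in B] = \sum_(i in B) prob (f @^-1` [set i]).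
Proof.
move=> mf; apply: EFin_inj.
rewrite prob_EFin; last exact: measurable_preimage.
rewrite preimage_fin_bigcup measure_fin_bigcup//; last first.
  by move=> i j _ _ [x [/= <- <-]].
rewrite (fsbigE (enum B))/=; last 3 first.
- exact: enum_uniq.
- by move=> i /=; rewrite mem_enum.
- by move=> i Bi; rewrite mem_enum Bi.
rewrite big_enum_cond/= -sumEFin; apply: eq_big => [i|i _].
  by rewrite mem_setE andbb.
by rewrite prob_EFin.
Qed.

Lemma preimage_comp1 (I J : finType) (f : T -> I) (h : I -> J) (j : J) :
  (h \o f) @^-1` [set j] = [set x | f x \in [pred i | h i == j]].
Proof. by apply/seteqP; split => x /= /eqP. Qed.

Lemma measurable_fibers_comp (I J : finType) (h : I -> J) (f : T -> I) :
  measurable_fibers f -> measurable_fibers (h \o f).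
Proof. by move=> mf j; rewrite preimage_comp1; exact: measurable_preimage. Qed.

Lemma prob_comp (I J : finType) (h : I -> J) (f : T -> I) (j : J) :
  measurable_fibers f ->
  prob ((h \o f) @^-1` [set j]) = \sum_(i | h i == j) prob (f @^-1` [set i]).
Proof. by move=> mf; rewrite preimage_comp1 prob_preimage. Qed.

Lemma sum_prob (I : finType) (f : T -> I) : measurable_fibers f ->
  \sum_i prob (f @^-1` [set i]) = 1.
Proof.
move=> mf; rewrite -(prob_preimage predT mf) -probT; congr prob.
by apply/seteqP; split.
Qed.

Lemma measurable_fibers_pair (I J : finType) (f : T -> I) (g : T -> J) :
  measurable_fibers f -> measurable_fibers g ->
  measurable_fibers (fun x => (f x, g x)).
Proof.
move=> mf mg [i j].
rewrite [X in measurable X](_ : _ = f @^-1` [set i] `&` g @^-1` [set j]).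
  exact: measurableI.
by apply/seteqP; split => x /= [-> ->].
Qed.

Lemma entropy_ge0 (I : finType) (f : T -> I) : measurable_fibers f ->
  0 <= entropy f.
Proof.
move=> mf; rewrite /entropy -sumrN sumr_ge0// => i _.
by rewrite -mulrN mulr_ge0 ?prob_ge0// oppr_ge0 ln_le0// prob_le1.
Qed.

(** ln t <= t - 1, applied to q i / p i, summed against the weights p i. *)
Lemma gibbs_inequality (I : finType) (p q : I -> R) :
  (forall i, 0 <= p i) -> (forall i, 0 <= q i) ->
  (forall i, 0 < p i -> 0 < q i) -> \sum_i q i <= \sum_i p i ->
  - \sum_i p i * ln (p i) <= - \sum_i p i * ln (q i).
Proof.
move=> p0 q0 pq spq; rewrite lerN2 -subr_ge0 -sumrB.
apply: (@le_trans _ _ (\sum_i (p i - q i))); first by rewrite sumrB subr_ge0.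
apply: ler_sum => i _.
have [pi0|pi0] := eqVneq (p i) 0; first by rewrite pi0 !mul0r subr0 sub0r oppr_le0.
have pi_gt0 : 0 < p i by rewrite lt_neqAle eq_sym pi0 p0.
have qi_gt0 := pq _ pi_gt0.
have /le_ln1Dx : -1 < q i / p i - 1 by rewrite ltrBrDr addNr divr_gt0.
rewrite addrC subrK ln_div ?posrE// => h.
rewrite -mulrBr -opprB -[leRHS]opprK lerN2 -mulrN opprB.
apply: le_trans (ler_wpM2l (ltW pi_gt0) h) _.
by rewrite mulrBr mulr1 mulrCA divff// mulr1.
Qed.

(** Each value of f is at most as likely as its image under h, and - ln is
    decreasing. *)
Lemma entropy_comp (I J : finType) (h : I -> J) (f : T -> I) :
  measurable_fibers f -> entropy (h \o f) <= entropy f.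
Proof.
move=> mf; rewrite /entropy.
have -> : \sum_j prob ((h \o f) @^-1` [set j]) * ln (prob ((h \o f) @^-1` [set j]))
    = \sum_i prob (f @^-1` [set i]) * ln (prob ((h \o f) @^-1` [set h i])).
  rewrite [RHS](partition_big h xpredT)//=; apply: eq_bigr => j _.
  rewrite [in X in X * _](prob_comp h j mf) mulr_suml.
  by apply: eq_bigr => i /eqP ->.
rewrite lerN2; apply: ler_sum => i _.
have [->|pi0] := eqVneq (prob (f @^-1` [set i])) 0; first by rewrite !mul0r.
have pi_gt0 : 0 < prob (f @^-1` [set i]) by rewrite lt_neqAle eq_sym pi0 prob_ge0.
have le_pi : prob (f @^-1` [set i]) <= prob ((h \o f) @^-1` [set h i]).
  apply: le_prob; [exact: mf|exact: measurable_fibers_comp|].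
  by move=> x /= ->.
by rewrite ler_wpM2l ?prob_ge0// ler_ln// posrE// (lt_le_trans pi_gt0).
Qed.

(** Gibbs' inequality for the joint law against the product of the marginals. *)
Lemma entropy_pair (I J : finType) (f : T -> I) (g : T -> J) :
  measurable_fibers f -> measurable_fibers g ->
  entropy (fun x => (f x, g x)) <= entropy f + entropy g.
Proof.
move=> mf mg; set fg := fun x => _.
have mfg : measurable_fibers fg by exact: measurable_fibers_pair.
set a := fun i => prob (f @^-1` [set i]).
set b := fun j => prob (g @^-1` [set j]).
set p := fun ij => prob (fg @^-1` [set ij]).
have aE i : a i = \sum_j p (i, j).
  rewrite /a (_ : f = fst \o fg)// prob_comp//.
  transitivity (\sum_(ij | pred1 i ij.1 && xpredT ij.2) p (ij.1, ij.2)).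
    by apply: eq_big => [[i' j']|[i' j'] _] //=; rewrite andbT.
  by rewrite -(pair_big (pred1 i) xpredT (fun i j => p (i, j)))/= big_pred1_eq.
have bE j : b j = \sum_i p (i, j).
  rewrite /b (_ : g = snd \o fg)// prob_comp//.
  transitivity (\sum_(ij | xpredT ij.1 && pred1 j ij.2) p (ij.1, ij.2)).
    by apply: eq_big => [[i' j']|[i' j'] _] //.
  rewrite -(pair_big xpredT (pred1 j) (fun i j => p (i, j)))/=.
  by apply: eq_bigr => i _; rewrite big_pred1_eq.
have p_ge0 ij : 0 <= p ij by exact: prob_ge0.
have pa ij : p ij <= a ij.1.
  by case: ij => i j; rewrite aE (bigD1 j)//= lerDl sumr_ge0.
have pb ij : p ij <= b ij.2.
  by case: ij => i j; rewrite bE (bigD1 i)//= lerDl sumr_ge0.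
apply: (@le_trans _ _ (- \sum_ij p ij * ln (a ij.1 * b ij.2))).
  apply: gibbs_inequality => //.
  - by move=> ij; rewrite mulr_ge0// prob_ge0.
  - by move=> ij pij; apply: mulr_gt0; [exact: lt_le_trans pij (pa ij)|
      exact: lt_le_trans pij (pb ij)].
  - rewrite (sum_prob mfg) -(pair_big xpredT xpredT (fun i j => a i * b j))/=.
    under eq_bigr do rewrite -mulr_sumr (sum_prob mg) mulr1.
    by rewrite (sum_prob mf).
rewrite /entropy -opprD lerN2 le_eqVlt; apply/orP; left; apply/eqP.
transitivity (\sum_ij (p ij * ln (a ij.1) + p ij * ln (b ij.2))).
  rewrite big_split/=; congr (_ + _).
    transitivity (\sum_ij p (ij.1, ij.2) * ln (a ij.1)); last first.
      by apply: eq_bigr => -[].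
    rewrite -(pair_big xpredT xpredT (fun i j => p (i, j) * ln (a i)))/=.
    by apply: eq_bigr => i _; rewrite -mulr_suml -aE.
  transitivity (\sum_ij p (ij.1, ij.2) * ln (b ij.2)); last first.
    by apply: eq_bigr => -[].
  rewrite -(pair_big xpredT xpredT (fun i j => p (i, j) * ln (b j)))/=.
  rewrite exchange_big; apply: eq_bigr => j _.
  by rewrite -mulr_suml -bE.
apply: eq_bigr => ij _.
have [->|pij0] := eqVneq (p ij) 0; first by rewrite !mul0r addr0.
have pij_gt0 : 0 < p ij by rewrite lt_neqAle eq_sym pij0 p_ge0.
by rewrite -mulrDr -lnM// posrE; [exact: lt_le_trans (pa ij)|
  exact: lt_le_trans (pb ij)].
Qed.

(** Gibbs' inequality against the uniform law. *)
Lemma entropy_le_ln_card (I : finType) (f : T -> I) : measurable_fibers f ->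
  entropy f <= ln #|I|%:R.
Proof.
move=> mf.
have I_gt0 : 0 < #|I|%:R :> R.
  by rewrite ltr0n; apply/card_gt0P; exists (f point).
apply: (@le_trans _ _ (- \sum_i prob (f @^-1` [set i]) * ln (#|I|%:R^-1))).
  apply: gibbs_inequality => // [i|i _|].
  - exact: prob_ge0.
  - by rewrite invr_gt0.
  - by rewrite sum_prob// sumr_const -[_ *+ _]mulr_natr mulVf// gt_eqF.
by rewrite -mulr_suml sum_prob// mul1r lnV ?posrE// opprK.
Qed.

(** From ln (1 / t) < 1 / t: the entropy of a cell of mass t ^ 2 is O(t). *)
Lemma entropy_term_le (t : R) : 0 <= t -> - (t ^+ 2 * ln (t ^+ 2)) <= t *+ 2.
Proof.
rewrite le_eqVlt => /orP[/eqP <-|t_gt0].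
  by rewrite expr0n/= mul0r oppr0 mul0rn.
rewrite lnXn// mulrnAr -mulNrn lerMn2r/= -mulrN -lnV ?posrE//.
have /ltW h := @ln_sublinear R t^-1 ltac:(by rewrite invr_gt0).
apply: le_trans (ler_wpM2l (exprn_ge0 2 (ltW t_gt0)) h) _.
by rewrite expr2 mulfK// gt_eqF.
Qed.

(** The term of the heavy cell is at most its defect from 1, because
    ln (1 / t) <= 1 / t - 1; each light cell contributes at most 2 s. *)
Lemma entropy_heavy_cell (I : finType) (f : T -> I) (i0 : I) (s : R) :
  measurable_fibers f -> 0 <= s ->
  prob [set x | f x != i0] <= s ^+ 2 ->
  entropy f <= s ^+ 2 + s *+ 2 *+ #|I|.
Proof.
move=> mf s0 hs; set p := fun i => prob (f @^-1` [set i]).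
have pE : prob [set x | f x != i0] = \sum_(i | i != i0) p i.
  by rewrite -(prob_preimage [pred i | i != i0] mf).
have p_ge0 i : 0 <= p i by exact: prob_ge0.
have p1 : p i0 + \sum_(i | i != i0) p i = 1 by rewrite -(sum_prob mf) [RHS](bigD1 i0).
rewrite /entropy -sumrN (bigD1 i0)//= lerD//.
  rewrite -/(p i0); apply: le_trans hs; rewrite pE.
  have [->|pi0] := eqVneq (p i0) 0; first by rewrite mul0r oppr0 sumr_ge0.
  have pi0_gt0 : 0 < p i0 by rewrite lt_neqAle eq_sym pi0 p_ge0.
  rewrite -mulrN -lnV ?posrE//.
  have /le_ln1Dx : -1 < (p i0)^-1 - 1 by rewrite ltrBrDr addNr invr_gt0.
  rewrite addrC subrK => /(ler_wpM2l (ltW pi0_gt0))/le_trans; apply.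
  by rewrite mulrBr divff// mulr1 -p1 addrAC subrr add0r.
apply: (@le_trans _ _ (\sum_(i | i != i0) s *+ 2)); last first.
  rewrite sumr_const; apply: ler_wpMn2l; last exact: max_card.
  by rewrite mulrn_wge0.
apply: ler_sum => i ii0; rewrite -/(p i).
have pis : p i <= s ^+ 2.
  by apply: le_trans hs; rewrite pE (bigD1 i)//= lerDl sumr_ge0.
rewrite -(sqr_sqrtr (p_ge0 i)); apply: le_trans (entropy_term_le _) _.
  exact: sqrtr_ge0.
by rewrite lerMn2r/= -[leRHS]ger0_norm// -(sqrtr_sqr s) ler_wsqrtr.
Qed.

(** An observation, given as a relation E x y to be read as the observer not
    telling x from y, that costs at most c: it is a coarsening of some finite
    partition of entropy at most c. Observations compose without having to name
    the finite types that carry their partitions. *)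
Definition entropy_bounded (E : T -> T -> Prop) (c : R) : Prop :=
  exists (I : finType) (f : T -> I),
    [/\ measurable_fibers f, forall x y, f x = f y -> E x y & entropy f <= c].

Lemma entropy_bounded_sub (E E' : T -> T -> Prop) c c' :
  (forall x y, E x y -> E' x y) -> c <= c' ->
  entropy_bounded E c -> entropy_bounded E' c'.
Proof.
move=> EE' cc' [I [f [mf fE fc]]]; exists I, f.
by split => // [x y /fE/EE'//|]; exact: le_trans cc'.
Qed.

Lemma entropy_bounded_and (E E' : T -> T -> Prop) c c' :
  entropy_bounded E c -> entropy_bounded E' c' ->
  entropy_bounded (fun x y => E x y /\ E' x y) (c + c').
Proof.
move=> [I [f [mf fE fc]]] [J [g [mg gE gc]]].
exists (I * J)%type, (fun x => (f x, g x)); split.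
- exact: measurable_fibers_pair.
- by move=> x y [/fE ? /gE].
- by apply: le_trans (entropy_pair mf mg) _; exact: lerD.
Qed.

Lemma entropy_bounded_all (S : eqType) (s : seq S) (E : S -> T -> T -> Prop) c :
  (forall a, a \in s -> entropy_bounded (E a) c) ->
  entropy_bounded (fun x y => forall a, a \in s -> E a x y) (c *+ size s).
Proof.
elim: s => [_|a s ih h].
  have mtt : measurable_fibers ((fun=> tt) : T -> unit).
    move=> i; rewrite [X in measurable X](_ : _ = setT)//.
    by apply/seteqP; split => x //= _; case: i.
  exists unit, (fun=> tt); split => //; rewrite mulr0n.
  by apply: le_trans (entropy_le_ln_card mtt) _; rewrite card_unit ln1.
have ha : entropy_bounded (E a) c by apply: h; rewrite mem_head.
have hs : entropy_bounded (fun x y => forall b, b \in s -> E b x y) (c *+ size s).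
  by apply: ih => b bs; apply: h; rewrite inE bs orbT.
apply: entropy_bounded_sub (entropy_bounded_and ha hs); last by rewrite /= mulrS.
by move=> x y [Ea Es] b; rewrite inE => /orP[/eqP ->//|/Es].
Qed.

(** The map f factors through any partition that determines it. *)
Lemma entropy_bounded_entropy (I : finType) (f : T -> I) c :
  entropy_bounded (fun x y => f x = f y) c -> entropy f <= c.
Proof.
move=> [J [g [mg gf gc]]]; apply: le_trans gc.
pose h j := f (xget point [set x | g x = j]).
rewrite (_ : f = h \o g); first exact: entropy_comp.
apply/funext => x /=; apply: gf; rewrite /=.
by have := @xgetI _ point [set y | g y = g x] x erefl => /= ->.
Qed.

End FiniteEntropy.

(** * Approximation of measurable sets by an algebra *)

Section Approximation.
Context d (T : measurableType d) (R : realType) (mu : probability T R).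
Local Notation prob := (prob mu).

Lemma prob_leU A B C : measurable A -> measurable B -> measurable C ->
  A `<=` B `|` C -> prob A <= prob B + prob C.
Proof.
move=> mA mB mC ABC; rewrite -lee_fin EFinD !prob_EFin//.
by apply: le_trans (measureU2 _ _ _) => //; rewrite le_measure ?inE//; exact: measurableU.
Qed.

Lemma prob_bigsetU (I : Type) (s : seq I) (F : I -> set T) :
  (forall i, measurable (F i)) ->
  prob (\big[setU/set0]_(i <- s) F i) <= \sum_(i <- s) prob (F i).
Proof.
move=> mF; have mS r : measurable (\big[setU/set0]_(i <- r) F i).
  by apply: bigsetU_measurable => i _.
elim: s => [|i s ih]; first by rewrite !big_nil prob0.
have := mS (i :: s); rewrite !big_cons => mis.
by apply: le_trans (prob_leU mis (mF i) (mS s) _) _ => //; rewrite lerD2l.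
Qed.

Lemma probD A B : measurable A -> measurable B -> B `<=` A ->
  prob (A `\` B) = prob A - prob B.
Proof.
move=> mA mB BA; apply/eqP; rewrite eq_sym subr_eq; apply/eqP/EFin_inj.
rewrite EFinD !prob_EFin//; last exact: measurableD.
by rewrite addeC (measureDI mu mA mB) setIidr// addeC.
Qed.

Context (algebra : set (set T)).
Hypothesis algebra0 : algebra set0.
Hypothesis algebraC : forall A, algebra A -> algebra (~` A).
Hypothesis algebraU : forall A B, algebra A -> algebra B -> algebra (A `|` B).
Hypothesis algebra_measurable : algebra `<=` measurable.

Definition approximable (A : set T) : Prop :=
  measurable A /\
  forall e : R, 0 < e -> exists2 C, algebra C & prob (A `+` C) <= e.

Lemma measurableY (A B : set T) : measurable A -> measurable B ->
  measurable (A `+` B).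
Proof. by move=> mA mB; rewrite setY_def; apply: measurableU; exact: measurableD. Qed.

Lemma setY_triangle (A B C : set T) : A `+` C `<=` (A `+` B) `|` (B `+` C).
Proof.
rewrite !setY_def => x /= [[Ax nCx]|[Cx nAx]].
  by have [Bx|nBx] := pselect (B x); [right; left|left; left].
by have [Bx|nBx] := pselect (B x); [left; right|right; right].
Qed.

(** Triangle inequality for the pseudodistance prob (A `+` B). *)
Lemma approximable_limit (A : set T) : measurable A ->
  (forall e, 0 < e -> exists2 B, approximable B & prob (A `+` B) <= e) ->
  approximable A.
Proof.
move=> mA h; split => // e e0.
have e20 : 0 < e / 2 by rewrite divr_gt0.
have [B [mB hB] ABe] := h _ e20; have [C aC BCe] := hB _ e20.
exists C => //; have mC := algebra_measurable aC.
rewrite [e]splitr; apply: le_trans (lerD ABe BCe).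
by apply: prob_leU => //; [exact: measurableY..|exact: setY_triangle].
Qed.

Lemma approximableC (A : set T) : approximable A -> approximable (~` A).
Proof.
move=> [mA hA]; split; first exact: measurableC.
move=> e /hA [C aC ACe]; exists (~` C); first exact: algebraC.
rewrite (_ : ~` A `+` ~` C = A `+` C)//.
by rewrite !setY_def !setDE !setCK setUC [in LHS](setIC _ A) [in LHS](setIC _ C).
Qed.

Lemma approximableU (A B : set T) : approximable A -> approximable B ->
  approximable (A `|` B).
Proof.
move=> [mA hA] [mB hB]; split; first exact: measurableU.
move=> e e0; have e20 : 0 < e / 2 by rewrite divr_gt0.
have [C aC ACe] := hA _ e20; have [D aD BDe] := hB _ e20.
exists (C `|` D); first exact: algebraU.
have mC := algebra_measurable aC; have mD := algebra_measurable aD.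
rewrite [e]splitr; apply: le_trans (lerD ACe BDe).
apply: prob_leU; [by apply: measurableY; exact: measurableU|exact: measurableY..|].
rewrite !setY_def => x /= [[[Ax|Bx] /not_orP[nC nD]]|[[Cx|Dx] /not_orP[nA nB]]].
- by left; left.
- by right; left.
- by left; right.
- by right; right.
Qed.

Lemma algebra_approximable : algebra `<=` approximable.
Proof.
move=> A aA; split; first exact: algebra_measurable.
by move=> e e0; exists A => //; rewrite setYK prob0 ltW.
Qed.

(** Countable unions follow from continuity of the measure from below: a finite
    union already carries almost all of the mass. *)
Lemma approximable_bigcup (F : nat -> set T) :
  (forall n, approximable (F n)) -> approximable (\bigcup_n F n).
Proof.
move=> aF; have mF n : measurable (F n) by case: (aF n).
pose G n := \big[setU/set0]_(i < n) F i.
have aG n : approximable (G n).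
  rewrite /G; elim/big_ind : _ => //; last by move=> A B; exact: approximableU.
  exact: algebra_approximable.
have mG n : measurable (G n) by case: (aG n).
have mU : measurable (\bigcup_n F n) by exact: bigcup_measurable.
have GU n : G n `<=` \bigcup_k F k by exact: bigsetU_bigcup.
have UG : \bigcup_n F n = \bigcup_n G n.
  apply/seteqP; split => [x [n _ Fx]|x [n _ /GU//]].
  by exists n.+1 => //; rewrite /G big_ord_recr; right.
apply: approximable_limit => // e e0.
have : mu (G n) @[n --> \oo] --> mu (\bigcup_n F n).
  rewrite UG; apply: nondecreasing_cvg_mu => //; first by rewrite -UG.
  by move=> m n mn; apply/subsetPset; exact: subset_bigsetU.
have -> : mu (\bigcup_n F n) = (prob (\bigcup_n F n))%:E by rewrite prob_EFin.
move=> /fine_cvgP[_] /cvgrPdist_le /(_ e e0) [n _ /(_ n (leqnn n))].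
rewrite /= -/(prob (G n)) => hn; exists (G n) => //.
have -> : \bigcup_n F n `+` G n = \bigcup_n F n `\` G n.
  by rewrite setY_def [X in _ `|` X](_ : _ = set0) ?setU0//; rewrite setD_eq0.
apply: le_trans hn; by apply: le_trans (ler_norm _); rewrite probD.
Qed.

Lemma sigma_algebra_approximable : sigma_algebra setT approximable.
Proof.
split; first exact: algebra_approximable.
  by move=> A aA; rewrite setTD; exact: approximableC.
exact: approximable_bigcup.
Qed.

End Approximation.

(** * Counting in Folner sets *)

Section FolnerCounting.
Local Open Scope fset_scope.
Context (R : realType) (G : groupType).
Implicit Types (F K : {fset G}) (A : set G).

Lemma mem_fset_prod K F (h g : G) :
  h \in K -> g \in F -> (h * g)%g \in fset_prod K F.
Proof.
move=> hK gF; apply/imfsetP; exists (h, g) => //=.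
by rewrite inE /= hK gF.
Qed.

Lemma folner_expansion (F : nat -> {fset G}) K (e : R) :
  folner R F -> K != fset0 -> 0 < e ->
  \forall n \near \oo, #|` fset_prod K (F n) `\` F n|%:R <= e * #|` F n|%:R.
Proof.
move=> [F0 hF] K0 e0; have := hF K e K0 e0; apply: filterS => n.
have Fn0 : 0 < #|` F n|%:R :> R by rewrite ltr0n cardfs_gt0.
rewrite ler_pdivrMr//; apply: le_trans; rewrite ler_nat.
exact/fsubset_leq_card/fsubsetUl.
Qed.

Lemma folner_card_prod (F : nat -> {fset G}) K :
  folner R F -> K != fset0 ->
  \forall n \near \oo, (#|` fset_prod K (F n)| <= 2 * #|` F n|)%N.
Proof.
move=> FF K0; have := folner_expansion FF K0 (@ltr01 R); apply: filterS => n.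
rewrite mul1r ler_nat => h; rewrite -(cardfsID (F n)) mul2n -addnn leq_add//.
exact/fsubset_leq_card/fsubsetIr.
Qed.

(** Fix a representative g in F of each class met by F: the products of
    elements of K with representatives are pairwise distinct elements of K F. *)
Lemma card_classes_mul (S : eqType) (c : G -> S) K F :
  (forall h g, h \in K -> c (h * g)%g = c g) ->
  (size (undup [seq c g | g <- F]) * #|` K| <= #|` fset_prod K F|)%N.
Proof.
move=> cK; set cs := undup _.
pose r a := xget 1%g [set g | g \in F /\ c g = a].
have rP a : a \in cs -> r a \in F /\ c (r a) = a.
  rewrite mem_undup => /mapP[g gF ->].
  by apply: (@xgetPex _ 1%g [set g' | g' \in F /\ c g' = c g]); exists g.
set pairs := [seq (h * r a)%g | a <- cs, h <- K].
rewrite -(size_allpairs (fun a h => (h * r a)%g)); apply: (@uniq_leq_size _ pairs).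
  apply: allpairs_uniq; [exact: undup_uniq|exact: fset_uniq|].
  move=> x y /allpairsP[[a h] /= [/rP[_ ra] hK ->]].
  move=> /allpairsP[[a' h'] /= [/rP[_ ra'] h'K ->]] /= eq_hr.
  have eq_a : a = a' by rewrite -ra -ra' -(cK h)// -(cK h' (r a'))// eq_hr.
  by move: eq_hr; rewrite eq_a => /mulIg ->.
move=> _ /allpairsP[[a h] /= [/rP[rF _] hK ->]]; exact: mem_fset_prod.
Qed.

Lemma card_fset_sum F (P : pred G) :
  #|` [fset g in F | P g]| = (\sum_(g <- F) P g)%N.
Proof.
transitivity (size (seq.filter P F)).
  apply/perm_size/uniq_perm; rewrite ?filter_uniq ?fset_uniq// => g.
  by rewrite mem_filter !inE/= andbC.
by rewrite size_filter -sum1_count big_mkcond.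
Qed.


(** Write N h for the number of g in F n with h g in A. The tiling hypothesis
    says that the N h, h in K, add up to |F n|. Sending g to h'^-1 h g shows that
    N h and N h' differ by at most |K F n \ F n|, so N 1 = |F n `&` A| is close
    to the average |F n| / |K|. *)
Lemma tiling_density (K : {fset G}) (A : set G) (F : nat -> {fset G}) :
  (forall h h', h \in K -> h' \in K -> (h'^-1 * h)%g \in K) ->
  (forall g, #|` [fset h in K | (h * g)%g \in A]| = 1%N) ->
  folner R F ->
  density_in R A (F n) @[n --> \oo] --> (#|` K|%:R^-1 : R).
Proof.
move=> KK tile FF.
have K0 : K != fset0.
  by apply/eqP => K0; have := tile 1%g; rewrite card_fset_sum K0 big_seq_fset0.
pose N n h := #|` [fset g in F n | (h * g)%g \in A]|.
pose D n := #|` fset_prod K (F n) `\` F n|.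
have N_sum n : (\sum_(h <- K) N n h = #|` F n|)%N.
  rewrite /N; under eq_bigr do rewrite card_fset_sum.
  rewrite exchange_big/= card_fset_sum1; apply: eq_bigr => g _.
  by rewrite -(tile g) card_fset_sum.
have N_le n h h' : h \in K -> h' \in K -> (N n h <= N n h' + D n)%N.
  move=> hK h'K; set B := [fset g in fset_prod K (F n) | (h' * g)%g \in A].
  apply: (@leq_trans #|` B|).
    set S := [fset g in F n | (h * g)%g \in A].
    have <- : #|` [fset (h'^-1 * h * g)%g | g in S]| = N n h.
      by apply: card_imfset; exact: mulgI.
    apply/fsubset_leq_card/fsubsetP => _ /imfsetP[g /= gF ->].
    move: gF; rewrite !inE /= => /andP[gF gA].
    by rewrite mem_fset_prod ?KK//= mulgA mulgA mulgV mul1g.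
  apply: (@leq_trans #|` [fset g in F n | (h' * g)%g \in A] `|`
      (fset_prod K (F n) `\` F n)|).
    apply/fsubset_leq_card/fsubsetP => g; rewrite !inE/= => /andP[-> ->].
    by rewrite !andbT orbN.
  by rewrite cardfsU leq_subr.
have K1 : 1%g \in K.
  by have [h hK] := fset0Pn K K0; rewrite -(mulVg h) KK.
have c0 : 0 < #|` K|%:R :> R by rewrite ltr0n cardfs_gt0.
have N1 n : N n 1%g = #|` [fset g in F n | g \in A]|.
  by rewrite /N; congr #|` _|; apply/fsetP => g; rewrite !inE/= mul1g.
have upper n : (#|` F n| <= #|` K| * (N n 1%g + D n))%N.
  rewrite -N_sum card_fset_sum1 big_distrl/= big_seq [leqRHS]big_seq.
  by apply: leq_sum => h hK; rewrite mul1n N_le.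
have lower n : (#|` K| * N n 1%g <= #|` F n| + #|` K| * D n)%N.
  rewrite -N_sum card_fset_sum1 !big_distrl/= -big_split/= big_seq [leqRHS]big_seq.
  by apply: leq_sum => h hK; rewrite !mul1n N_le.
apply/cvgrPdist_le => e e0.
have := folner_expansion FF K0 e0; apply: filterS => n hn.
have F0 : 0 < #|` F n|%:R :> R by rewrite ltr0n cardfs_gt0; case: FF.
rewrite /density_in -N1 ler_distlC; apply/andP; split.
  rewrite lerBlDr -(ler_pM2l c0) mulfV ?gt_eqF// mulrDr.
  rewrite -(ler_pM2r F0) mul1r mulrDl -!mulrA mulVf ?gt_eqF// mulr1.
  have := upper n; rewrite -(ler_nat R) natrM natrD => /le_trans; apply.
  by rewrite mulrDr lerD2l ler_pM2l.
rewrite -(ler_pM2l c0) mulrDr mulfV ?gt_eqF// -(ler_pM2r F0) mulrDl mul1r.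
rewrite -!mulrA mulVf ?gt_eqF// mulr1.
have := lower n; rewrite -(ler_nat R) natrD !natrM => /le_trans; apply.
by rewrite lerD2l ler_pM2l.
Qed.

End FolnerCounting.

(** * The space of binary relations *)

(** The shift by one makes pos a bijection from nat; the points 1, ..., n are
    then pos i for i : 'I_n. *)
Definition pos (n : nat) : posnat := exist _ n.+1 (ltn0Sn n).

Lemma pos_pred (i : posnat) : pos (val i).-1 = i.
Proof. by apply/val_inj; rewrite /= prednK ?(valP i). Qed.

(** The parameter R is the field in which the distance takes its values. *)
Definition relation_space (R : realType) : Type := posnat -> posnat -> bool.

Section RelationSpace.
Context (R : realType).
Local Notation X := (relation_space R).

HB.instance Definition _ := gen_eqMixin X.
HB.instance Definition _ := gen_choiceMixin X.
HB.instance Definition _ :=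
  isPointed.Build X (fun _ _ => false).

Implicit Types x y z : X.

Definition agree (n : nat) x y : Prop :=
  forall i j : posnat, (val i <= n)%N -> (val j <= n)%N -> x i j = y i j.

Lemma agree_sym n x y : agree n x y -> agree n y x.
Proof. by move=> h i j ? ?; rewrite h. Qed.

Lemma agree_trans n x y z : agree n x y -> agree n y z -> agree n x z.
Proof. by move=> h h' i j ? ?; rewrite h ?h'. Qed.

Lemma agree_le m n x y : (m <= n)%N -> agree n x y -> agree m x y.
Proof. by move=> mn h i j im jm; apply: h; exact: leq_trans mn. Qed.

Lemma agree0 x y : agree 0 x y.
Proof. by move=> i j; rewrite leqNgt (valP i). Qed.

Lemma agree_eq x y : (forall n, agree n x y) -> x = y.
Proof.
move=> h; apply/funext => i; apply/funext => j.
by apply: (h (maxn (val i) (val j))); rewrite leq_max leqnn ?orbT.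
Qed.

(** The usual ultrametric: 1 / n for the first n at which the restrictions to
    {1, ..., n} differ, and 0 if they never do. *)
Definition rdist x y : R :=
  if pselect (exists n, `[< ~ agree n x y >]) is left e
  then (ex_minn e)%:R^-1 else 0.

Lemma rdist_lt n x y : (0 < n)%N -> rdist x y < n%:R^-1 <-> agree n x y.
Proof.
move=> n0; rewrite /rdist; case: pselect => [e|ne]; last first.
  rewrite invr_gt0 ltr0n n0; split => // _.
  by apply: contrapT => h; apply: ne; exists n; apply/asboolP.
case: ex_minnP => m /asboolP nm hm.
have m0 : (0 < m)%N by case: (m) nm => // /(_ (agree0 x y)).
rewrite ltf_pV2 ?posrE ?ltr0n// ltr_nat; split => [nm'|an].
  by apply: contrapT => h; have := hm n (introT (asboolP _) h); rewrite leqNgt nm'.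
by rewrite ltnNge; apply/negP => mn; apply: nm; exact: agree_le an.
Qed.

Lemma rdist_ge n x y : ~ agree n x y -> n%:R^-1 <= rdist x y.
Proof.
case: n => [h|n h]; first by case: h; exact: agree0.
by rewrite leNgt; apply/negP; rewrite rdist_lt.
Qed.

Lemma rdist_cases x y : x = y /\ rdist x y = 0 \/
  exists n, ~ agree n x y /\ rdist x y = n%:R^-1.
Proof.
rewrite /rdist; case: pselect => [e|ne]; last first.
  left; split => //; apply: agree_eq => n.
  by apply: contrapT => h; apply: ne; exists n; apply/asboolP.
by case: ex_minnP => m /asboolP nm _; right; exists m.
Qed.

Lemma rdist_ge0 x y : 0 <= rdist x y.
Proof.
by have [[_ ->//]|[n [_ ->]]] := rdist_cases x y; rewrite invr_ge0.
Qed.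

Lemma rdistxx x : rdist x x = 0.
Proof. by have [[]//|[n []]] := rdist_cases x x; case. Qed.

Lemma rdist_eq0 x y : rdist x y = 0 -> x = y.
Proof.
have [[]//|[[|n] [h ->]]] := rdist_cases x y; first by case: h; exact: agree0.
by move/eqP; rewrite invr_eq0 pnatr_eq0.
Qed.

Lemma rdist_sym x y : rdist x y = rdist y x.
Proof.
suff le a b : rdist a b <= rdist b a by apply/eqP; rewrite eq_le !le.
have [[_ ->]|[n [h ->]]] := rdist_cases a b; first exact: rdist_ge0.
by apply: rdist_ge => /agree_sym.
Qed.

Lemma rdist_triangle y x z : rdist x z <= rdist x y + rdist y z.
Proof.
have [[_ ->]|[n [h ->]]] := rdist_cases x z; first by rewrite addr_ge0 ?rdist_ge0.
have [xy|xy] := pselect (agree n x y).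
  have yz : ~ agree n y z by move=> yz; apply: h; exact: agree_trans yz.
  by apply: le_trans (rdist_ge yz) _; rewrite lerDr rdist_ge0.
by apply: le_trans (rdist_ge xy) _; rewrite lerDl rdist_ge0.
Qed.

HB.instance Definition _ := isMetric.Build R X
  rdistxx rdist_eq0 rdist_sym rdist_triangle.

Lemma nbhs_agree x (U : set X) :
  nbhs x U <-> exists n, [set y | agree n x y] `<=` U.
Proof.
split.
  move=> /nbhs_ballP[e /= e0 he].
  have [n ne] : exists n : nat, n.+1%:R^-1 < e.
    exists (Num.truncn e^-1); rewrite invf_plt ?posrE// truncnS_gt//.
  exists n.+1 => y xy; apply: he; rewrite ballEmdist/=.
  by apply: lt_trans ne; apply/rdist_lt.
move=> [n hn]; apply/nbhs_ballP; exists n.+1%:R^-1 => /=; first by rewrite invr_gt0.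
move=> y; rewrite ballEmdist/= => /rdist_lt h; apply: hn.
by apply: agree_le (h _).
Qed.

(** The metric topology is coarser than the product topology, which is compact
    by Tychonoff's theorem. *)
Lemma relation_space_compact : compact [set: X].
Proof.
pose P := prod_topology (fun _ : posnat * posnat => bool).
have cP : compact [set: P].
  rewrite (_ : [set: P] = [set f : P | forall i, [set: bool] (f i)]).
    exact: (@tychonoff _ (fun=> bool : topologicalType) (fun=> setT) (fun=> bool_compact)).
  by apply/seteqP; split.
pose curry (f : P) : X := fun i j => f (i, j).
have curry_cont : continuous curry.
  move=> f U /nbhs_agree[n hn].
  have : \forall g \near f, forall ij : 'I_n * 'I_n,
      g (pos ij.1, pos ij.2) = f (pos ij.1, pos ij.2).
    apply: (@filter_forall _ _ (fun ij : 'I_n * 'I_n => [set g : P |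
      g (pos ij.1, pos ij.2) = f (pos ij.1, pos ij.2)]) (nbhs f)) => -[i j] /=.
    have /(_ [set f (pos i, pos j)]) :=
      @proj_continuous _ (fun _ : posnat * posnat => bool : topologicalType) (pos i, pos j) f.
    by apply; exact: discrete_set1.
  apply: filterS => g hg; apply: hn => i j lei lej.
  have lti (k : posnat) : (val k <= n)%N -> ((val k).-1 < n)%N.
    by rewrite prednK ?(valP k).
  have := hg (Ordinal (lti _ lei), Ordinal (lti _ lej)).
  by rewrite /= !pos_pred.
rewrite (_ : [set: X] = curry @` [set: P]).
  by apply: continuous_compact cP; exact: continuous_subspaceT.
apply/seteqP; split => // x _; exists (fun ij => x ij.1 ij.2) => //.
Qed.

Definition finitely_determined (A : set X) : Prop :=
  exists n, forall x y, agree n x y -> A x -> A y.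

Lemma finitely_determined_open : finitely_determined `<=` open.
Proof.
move=> A [n hA]; rewrite openE => x Ax; apply/nbhs_agree; exists n => y xy.
exact: hA xy Ax.
Qed.

(** An open set is the union over n of the points whose n-th neighbourhood lies
    in it, and the condition at stage n only looks at that neighbourhood. *)
Lemma open_finitely_determined (U : set X) : open U ->
  exists2 E : nat -> set X,
    forall n, finitely_determined (E n) & U = \bigcup_n E n.
Proof.
rewrite openE => oU; exists (fun n => [set x | [set y | agree n x y] `<=` U]).
  move=> n; exists n => x y xy /= hx z yz; apply: hx => /=.
  exact: agree_trans yz.
apply/seteqP; split => [x /oU /nbhs_agree[n hn]|x [n _ hx]]; first by exists n.
exact: hx.
Qed.

Lemma finitely_determined0 : finitely_determined set0.
Proof. by exists 0%N. Qed.

Lemma finitely_determinedC (A : set X) :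
  finitely_determined A -> finitely_determined (~` A).
Proof. by move=> [n hA]; exists n => x y /agree_sym/hA xy nx /xy. Qed.

Lemma finitely_determinedU (A B : set X) : finitely_determined A ->
  finitely_determined B -> finitely_determined (A `|` B).
Proof.
move=> [m hA] [n hB]; exists (maxn m n) => x y xy [Ax|Bx].
  by left; apply: hA Ax; apply: agree_le xy; exact: leq_maxl.
by right; apply: hB Bx; apply: agree_le xy; exact: leq_maxr.
Qed.

Lemma finitely_determined_measurable :
  finitely_determined `<=` (@measurable _ (borel X)).
Proof. by move=> A /finitely_determined_open oA; exact: sub_sigma_algebra. Qed.

(** Open sets are countable unions of finitely determined sets. *)
Lemma borel_approximable (mu : probability (borel X) R) (A : set (borel X)) :
  measurable A -> approximable mu finitely_determined A.
Proof.
apply: smallest_sub.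
  apply: sigma_algebra_approximable.
  - exact: finitely_determined0.
  - exact: finitely_determinedC.
  - exact: finitely_determinedU.
  - exact: finitely_determined_measurable.
move=> U /open_finitely_determined[E fE ->].
apply: approximable_bigcup.
- exact: finitely_determined0.
- exact: finitely_determinedU.
- exact: finitely_determined_measurable.
- by move=> n; apply: algebra_approximable (fE n); exact: finitely_determined_measurable.
Qed.

End RelationSpace.

Section Relabelling.
Context (R : realType).
Local Notation X := (relation_space R).
Local Notation G := (fperm posnat).

Definition relabel (g : G) (x : X) : X := fun i j => x (g i) (g j).

(** Take N above g(1), ..., g(n). *)
Lemma relabel_agree (g : G) (n : nat) :
  exists N, forall x y : X, agree N x y -> agree n (relabel g x) (relabel g y).
Proof.
pose N := (\max_(i < n) val (g (pos i)))%N.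
have gN (i : posnat) : (val i <= n)%N -> (val (g i) <= N)%N.
  move=> le_in.
  have lt_in : ((val i).-1 < n)%N by rewrite prednK ?(valP i).
  rewrite -[i]pos_pred; exact: (@leq_bigmax _ (fun i : 'I_n => val (g (pos i))) (Ordinal lt_in)).
by exists N => x y xy i j lei lej; apply: xy; exact: gN.
Qed.

Lemma relabel_continuous (g : G) : continuous (relabel g).
Proof.
move=> x U /nbhs_agree[n hn]; have [N hN] := relabel_agree g n.
by apply/nbhs_agree; exists N => y /hN/hn.
Qed.

Lemma relabel_dynamical_system : dynamical_system relabel.
Proof.
split => //; first exact: relation_space_compact.
exact: relabel_continuous.
Qed.

Lemma relabel_measurable (g : G) (A : set (borel X)) : measurable A ->
  measurable (relabel g @^-1` A : set (borel X)).
Proof.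
move: A; apply: smallest_sub.
  split => [|A mA|F mF].
  - by rewrite preimage_set0; exact: measurable0.
  - by rewrite setTD preimage_setC; exact: measurableC.
  - by rewrite preimage_bigcup; exact: bigcup_measurable.
move=> U oU; apply: sub_sigma_algebra.
by apply: open_comp oU => x _; exact: relabel_continuous.
Qed.

End Relabelling.

(** * Finite symmetric groups and the density *)

Section SymmetricGroups.
Local Open Scope fset_scope.
Local Notation G := (fperm posnat).

Lemma finite_posnat_le (n : nat) : finite_set [set x : posnat | (val x <= n)%N].
Proof.
apply: (@sub_finite_set _ _ (pos @` `I_n)); last exact: finite_image.
by move=> x /= xn; exists (val x).-1; rewrite /= ?pos_pred ?prednK ?(valP x).
Qed.

Section Swap.
Variables a b : posnat.
Definition swap_fun (x : posnat) := if x == a then b else if x == b then a else x.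

Lemma swap_funK : involutive swap_fun.
Proof.
move=> x; rewrite /swap_fun; have [->|xa] := eqVneq x a.
  by rewrite eqxx; case: eqVneq.
by have [->|xb] := eqVneq x b; rewrite ?eqxx// (negbTE xa) (negbTE xb).
Qed.

Lemma swap_fun_fin : finite_set [set x | swap_fun x <> x].
Proof.
apply: (@sub_finite_set _ _ [set a; b]) => [x /=|]; last exact: finite_set2.
by rewrite /swap_fun; case: eqVneq => [->|_]; [left|case: eqVneq => [->|_]; [right|]].
Qed.

Definition swap : G := FPerm (inv_bij swap_funK) swap_fun_fin.
End Swap.

(** Infinitely many permutations fix 1, ..., n: the transpositions of n + 1 with
    the later points. *)
Lemma large_pointwise_stabilizer (n M : nat) : exists2 K : {fset G},
  #|` K| = M & forall h, h \in K -> forall i : posnat, (val i <= n)%N -> h i = i.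
Proof.
pose s (j : 'I_M) := swap (pos n) (pos (n.+1 + j)).
have s_inj : injective s.
  move=> i j /(congr1 (fun h : G => val (h (pos n)))).
  by rewrite /= /swap_fun eqxx /= => /eqP; rewrite !addSn !eqSS eqn_add2l => /eqP/val_inj.
exists [fset s j | j in 'I_M].
  by rewrite card_imfset// -[RHS]card_ord cardE.
move=> _ /imfsetP[j _ ->] i le_in; rewrite /= /swap_fun.
have -> : (i == pos n) = false.
  by apply/eqP => i_n; move: le_in; rewrite i_n /= ltnn.
rewrite ifF//; apply/eqP => i_n; move: le_in.
by rewrite i_n /= addSn => /ltnW; rewrite ltnNge leq_addr.
Qed.

Section Embedding.
Variables n : nat.
Implicit Types s t : 'S_n.

Definition emb_fun s (x : posnat) : posnat :=
  if insub (val x).-1 is Some i then pos (s i) else x.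

Lemma emb_fun_pos s (i : 'I_n) : emb_fun s (pos i) = pos (s i).
Proof. by rewrite /emb_fun /= valK. Qed.

Lemma emb_fun_big s x : (n < val x)%N -> emb_fun s x = x.
Proof. by move=> nx; rewrite /emb_fun insubN// -leqNgt -ltnS prednK ?(valP x). Qed.

Lemma posnatP (x : posnat) : (exists i : 'I_n, x = pos i) \/ (n < val x)%N.
Proof.
have [|xn] := ltnP n (val x); [by right|left].
have lt_x : ((val x).-1 < n)%N by rewrite prednK ?(valP x).
by exists (Ordinal lt_x); rewrite /= pos_pred.
Qed.

Lemma emb_funK s t : cancel s t -> cancel (emb_fun s) (emb_fun t).
Proof.
move=> st x; case: (posnatP x) => [[i ->]|nx]; first by rewrite !emb_fun_pos st.
by rewrite !emb_fun_big.
Qed.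

Lemma emb_fun_bij s : bijective (emb_fun s).
Proof. by exists (emb_fun s^-1%g); apply: emb_funK; [exact: permK|exact: permKV]. Qed.

Lemma emb_fun_fin s : finite_set [set x | emb_fun s x <> x].
Proof.
apply: sub_finite_set (finite_posnat_le n) => x /= h.
by rewrite leqNgt; apply/negP => /(emb_fun_big s).
Qed.

Definition emb s : G := FPerm (emb_fun_bij s) (emb_fun_fin s).

Lemma emb_inj : injective emb.
Proof.
move=> s t /(congr1 (fun g : G => fperm_fun g)) /= st; apply/permP => i.
have := congr1 (fun f => val (f (pos i))) st.
by rewrite /= !emb_fun_pos => -[] /val_inj.
Qed.

Definition Sym : {fset G} := [fset emb s | s in 'S_n].

Lemma card_Sym : #|` Sym| = n`!.
Proof. by rewrite card_imfset//=; [rewrite -cardE card_Sn|exact: emb_inj]. Qed.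

(** A permutation fixing everything above n maps {1, ..., n} to itself, by
    injectivity. *)
Lemma mem_Sym (g : G) :
  g \in Sym <-> forall x : posnat, (n < val x)%N -> g x = x.
Proof.
split=> [/imfsetP[s _ ->] x|hg]; first exact: emb_fun_big.
have g_inj : injective g := bij_inj (fperm_bij g).
have ltg (i : 'I_n) : ((val (g (pos i))).-1 < n)%N.
  rewrite prednK ?(valP (g _))// leqNgt; apply/negP => h.
  have := hg _ h => /g_inj gi; move: h; rewrite gi /=.
  by rewrite ltnNge ltn_ord.
pose f i := Ordinal (ltg i).
have f_inj : injective f.
  move=> i j /(congr1 (fun k => pos (val k))); rewrite /= !pos_pred => /g_inj.
  by move=> /(congr1 val)[] /val_inj.
apply/imfsetP; exists (perm f_inj) => //; apply: fpermP => x /=.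
case: (posnatP x) => [[i ->]|nx]; last by rewrite emb_fun_big ?hg.
by rewrite emb_fun_pos permE /= pos_pred.
Qed.

End Embedding.

Lemma Sym_mul n (g h : G) : g \in Sym n -> h \in Sym n -> (g * h)%g \in Sym n.
Proof.
move=> /mem_Sym gS /mem_Sym hS; apply/mem_Sym => x nx.
by rewrite fperm_mulE gS// hS.
Qed.

Lemma Sym_inv n (g : G) : g \in Sym n -> (g^-1)%g \in Sym n.
Proof.
move=> /mem_Sym gS; apply/mem_Sym => x nx.
by rewrite -[in LHS](gS x nx) -fperm_mulE mulgV.
Qed.

Lemma Sym_neq0 n : Sym n != fset0.
Proof. by rewrite -cardfs_gt0 card_Sym fact_gt0. Qed.

Lemma Sym_le m n : (m <= n)%N -> {subset Sym m <= Sym n}.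
Proof.
by move=> mn g /mem_Sym h; apply/mem_Sym => x nx; apply: h; exact: leq_ltn_trans nx.
Qed.

Lemma fperm_in_Sym (g : G) : exists n, g \in Sym n.
Proof.
have /finite_fsetP[S hS] := fperm_fin g.
exists (\max_(x <- S) val x)%N; apply/mem_Sym => x Sx; apply: contrapT => gx.
have xS : x \in S by have : [set` S] x by rewrite -hS.
move: Sx; rewrite ltnNge => /negP; apply.
by rewrite (big_fsetD1 x)//= leq_maxl.
Qed.

Lemma fset_sub_Sym (K : {fset G}) : exists n, {subset K <= Sym n}.
Proof.
have [N hN] := choice fperm_in_Sym.
exists (\max_(g <- K) N g)%N => g gK; apply: Sym_le (hN g).
by rewrite (big_fsetD1 g)//= leq_maxl.
Qed.

(** Each finite K lies in some Sym m, and K Sym n = Sym n once m <= n. *)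
Lemma folner_Sym (R : realType) : folner R Sym.
Proof.
split; first exact: Sym_neq0.
move=> K e K0 e0; have [m Km] := fset_sub_Sym K.
exists m => // n /= mn.
have -> : fset_prod K (Sym n) = Sym n.
  apply/fsetP => g; apply/imfsetP/idP => [[[h f]]|gS] /=.
    by rewrite inE /= => /andP[/Km/(Sym_le mn) hS fS] ->; exact: Sym_mul.
  have [h hK] := fset0Pn K K0; exists (h, h^-1 * g)%g => /=.
    by rewrite inE /= hK Sym_mul// Sym_inv// (Sym_le mn)// Km.
  by rewrite mulgA mulgV mul1g.
by rewrite /fset_symdiff fsetDv fsetU0 cardfs0 mul0r ltW.
Qed.

Lemma sorting_perm_exists k (a : 'I_k -> nat) : injective a ->
  exists s : 'S_k, forall i j : 'I_k, (i < j)%N -> (a (s i) < a (s j))%N.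
Proof.
move=> a_inj; pose l := sort (fun i j => a i <= a j)%N (enum 'I_k).
have l_size : size l = k by rewrite size_sort -cardE card_ord.
have l_uniq : uniq l by rewrite sort_uniq enum_uniq.
have l_sorted : sorted (fun i j => a i <= a j)%N l.
  by apply: sort_sorted => i j; exact: leq_total.
have f_inj : injective (fun i : 'I_k => nth i l i).
  move=> i j /eqP; rewrite (set_nth_default i j) ?l_size//.
  by rewrite nth_uniq ?l_size// => /eqP/val_inj.
exists (perm f_inj) => i j ij; rewrite !permE (set_nth_default i j) ?l_size//.
rewrite ltn_neqAle (inj_eq a_inj) nth_uniq ?l_size// ltn_eqF//=.
apply: (sorted_ltn_nth _ i l_sorted) => //; rewrite ?inE ?l_size//.
by move=> x y z; exact: leq_trans.
Qed.

(** Both arrangements list the values of a in increasing order, and a strictly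
    sorted list is determined by its elements. *)
Lemma sorting_perm_unique k (a : 'I_k -> nat) (s t : 'S_k) : injective a ->
  (forall i j : 'I_k, (i < j)%N -> (a (s i) < a (s j))%N) ->
  (forall i j : 'I_k, (i < j)%N -> (a (t i) < a (t j))%N) -> s = t.
Proof.
move=> a_inj hs ht.
have enum_sorted : sorted (fun i j : 'I_k => i < j)%N (enum 'I_k).
  by have := iota_ltn_sorted 0 k; rewrite -val_enum_ord sorted_map.
have map_sorted (u : 'S_k) : (forall i j : 'I_k, (i < j)%N -> (a (u i) < a (u j))%N) ->
    sorted ltn [seq a (u i) | i <- enum 'I_k].
  by move=> hu; rewrite sorted_map; apply: sub_sorted enum_sorted => i j /hu.
have map_mem (u : 'S_k) x : x \in [seq a (u i) | i <- enum 'I_k] = (x \in codom a).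
  apply/mapP/codomP => [[i _ ->]|[i ->]]; first by exists (u i).
  by exists (u^-1 i)%g; rewrite ?mem_enum// permKV.
have : [seq a (s i) | i <- enum 'I_k] = [seq a (t i) | i <- enum 'I_k].
  apply: (irr_sorted_eq ltn_trans ltnn); rewrite ?map_sorted// => x.
  by rewrite !map_mem.
move=> /eq_in_map st; apply/permP => i; apply: a_inj; apply: st.
by rewrite mem_enum.
Qed.

(** As (h g)(i) = g(h(i)), multiplying by h in Sym k on the left rearranges the
    distinct numbers g(1), ..., g(k), and one rearrangement is increasing. *)
Lemma C_incr_tile k (g : G) :
  #|` [fset h in Sym k | (h * g)%g \in C_incr k]| = 1%N.
Proof.
pose a (i : 'I_k) := val (g (pos i)).
have a_inj : injective a.
  by move=> i j /val_inj /(bij_inj (fperm_bij g)) /(congr1 val)[] /val_inj.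
have memC (s : 'S_k) : (emb s * g)%g \in C_incr k <->
    forall i j : 'I_k, (i < j)%N -> (a (s i) < a (s j))%N.
  rewrite inE /=; split=> [h i j ij|h i j].
    have := h (pos i) (pos j); rewrite /= !emb_fun_pos; apply.
      by rewrite ltnS.
    exact: ltn_ord.
  case: (posnatP k i) => [[i' ->]|ki] ij kj.
    case: (posnatP k j) kj ij => [[j' ->] _ ij|]; last by rewrite ltnNge => /negbTE ->.
    by rewrite !fperm_mulE /= !emb_fun_pos; apply: h.
  by have := leq_trans (ltn_trans ki ij) kj; rewrite ltnn.
have [s hs] := sorting_perm_exists a_inj.
rewrite (_ : [fset h in Sym k | _] = [fset emb s]) ?cardfs1//.
apply/fsetP => h; rewrite !inE /=; apply/andP/eqP => [[/imfsetP[t _ ->] /memC ht]|->].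
  by congr emb; exact: sorting_perm_unique ht hs.
by split; [apply/imfsetP; exists s|apply/memC].
Qed.

Lemma C_incr_density (R : realType) k :
  has_banach_density (C_incr k) (k`!%:R^-1 : R).
Proof.
have cvg (F : nat -> {fset G}) : folner R F ->
    (density_in R (C_incr k) (F n))%:E @[n --> \oo] --> (k`!%:R^-1)%:E.
  move=> FF; apply: cvg_EFin; first by near=> n.
  rewrite -card_Sym; apply: tiling_density FF => //.
    by move=> h h' hS h'S; rewrite Sym_mul// Sym_inv.
  exact: C_incr_tile.
split; rewrite /upper_banach_density /lower_banach_density.
  rewrite (_ : [set _ | _ in _] = [set (k`!%:R^-1)%:E]) ?ereal_sup1//.
  apply/seteqP; split => [_ [F /cvg/cvg_limn_einf_sup[_ ->] <-]//|_ ->].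
  by exists Sym; [exact: folner_Sym|rewrite (cvg_limn_einf_sup (cvg _ (folner_Sym R))).2].
rewrite (_ : [set _ | _ in _] = [set (k`!%:R^-1)%:E]) ?ereal_inf1//.
apply/seteqP; split => [_ [F /cvg/cvg_limn_einf_sup[-> _] <-]//|_ ->].
by exists Sym; [exact: folner_Sym|rewrite (cvg_limn_einf_sup (cvg _ (folner_Sym R))).1].
Unshelve. all: by end_near. Qed.

End SymmetricGroups.

(** * Entropy zero *)

Section ZeroEntropy.
Context (R : realType).
Local Notation X := (relation_space R).
Local Notation G := (fperm posnat).
Implicit Types (mu : probability (borel X) R).

Lemma relabel_measurable_fibers (I : finType) (f : borel X -> I) (g : G) :
  measurable_fibers f -> measurable_fibers (f \o relabel g : borel X -> I).
Proof. by move=> mf i; rewrite comp_preimage; exact: relabel_measurable. Qed.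

Lemma relabel_entropy mu (I : finType) (f : borel X -> I) (g : G) :
  invariant_measure (@relabel R) mu -> measurable_fibers f ->
  entropy mu (f \o relabel g : borel X -> I) = entropy mu f.
Proof.
move=> inv mf; rewrite /entropy; congr (- _); apply: eq_bigr => i _.
by rewrite comp_preimage /prob inv.
Qed.

Lemma agree_measurable_fibers (I : finType) (n : nat) (Q : X -> I) :
  (forall x y, agree n x y -> Q x = Q y) ->
  measurable_fibers (Q : borel X -> I).
Proof.
move=> hQ i; apply: finitely_determined_measurable.
by exists n => x y /hQ /= ->.
Qed.

(** Approximate each cell P i by a finitely determined set C i, and let Q x be
    some i with x in C i. Outside the union of the symmetric differences of P i
    and C i, only i = P x qualifies. *)
Lemma finite_partition_approximation mu (m : nat) (P : borel X -> 'I_m) (e : R) :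
  measurable_fibers P -> 0 < e ->
  exists n (Q : X -> option 'I_m),
    (forall x y, agree n x y -> Q x = Q y) /\
    prob mu [set x | Q x != Some (P x)] <= e.
Proof.
move=> mP e0.
have m0 : 0 < m%:R :> R by rewrite ltr0n; case: m P mP => // P _; case: (P point).
have em0 : 0 < e / m%:R by rewrite divr_gt0.
have /choice[C hC] (i : 'I_m) : exists C : set X, finitely_determined C /\
    prob mu (P @^-1` [set i] `+` C) <= e / m%:R.
  by have [_ /(_ _ em0)[C ? ?]] := borel_approximable mu (mP i); exists C.
have /choice[N hN] (i : 'I_m) : exists n, forall x y, agree n x y -> C i x -> C i y.
  by have [] := hC i.
pose n := (\max_i N i)%N.
have nC i x y : agree n x y -> C i x -> C i y.
  by move=> xy; apply: hN; apply: agree_le xy; exact: leq_bigmax.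
pose Q (x : X) : option 'I_m := [pick i | `[< C i x >]].
have nQ x y : agree n x y -> Q x = Q y.
  move=> xy; apply: eq_pick => i; apply/asboolP/asboolP; first exact: nC.
  exact/nC/agree_sym.
exists n, Q; split => //.
have mC i : measurable (C i : set (borel X)).
  by apply: finitely_determined_measurable; case: (hC i).
have mY i : measurable (P @^-1` [set i] `+` C i : set (borel X)).
  by apply: measurableY => //; exact: mP.
have QP : [set x | Q x != Some (P x)] `<=`
    \big[setU/set0]_(i <- enum 'I_m) (P @^-1` [set i] `+` C i).
  move=> x /= QPx; apply: contrapT => nx; move: QPx.
  rewrite (_ : Q x = Some (P x)) ?eqxx//.
  have CP i : C i x <-> P x = i.
    have : ~ (P @^-1` [set i] `+` C i) x.
      by move=> h; apply: nx; rewrite -bigcup_seq; exists i => //=; rewrite mem_enum.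
    rewrite setY_def => /not_orP[/not_andP h1 /not_andP h2]; split.
      by move=> Cx; case: h2 => // /contrapT.
    by move=> Pi; case: h1 => // /contrapT.
  rewrite /Q; case: pickP => [i /asboolP/CP <-//|/(_ (P x)) /asboolP].
  by case; apply/CP.
have mQP : measurable ([set x | Q x != Some (P x)] : set (borel X)).
  have := measurable_fibers_pair (agree_measurable_fibers nQ) mP.
  exact: (@measurable_preimage _ _ _ _ [pred qp | qp.1 != Some qp.2]).
apply: le_trans (le_prob _ mQP _ QP) _.
  by apply: bigsetU_measurable => i _.
apply: le_trans (prob_bigsetU _ _ mY) _.
apply: (@le_trans _ _ (\sum_(i <- enum 'I_m) e / m%:R)).
  by apply: ler_sum => i _; case: (hC i).
rewrite big_enum/= sumr_const card_ord -[_ *+ _]mulr_natr divfK//.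
by rewrite gt_eqF.
Qed.

Definition restriction (n : nat) (g : G) : seq posnat :=
  [seq g (pos i) | i <- iota 0 n].

Lemma restriction_agree n (g h : G) (x : X) :
  restriction n g = restriction n h -> agree n (relabel g x) (relabel h x).
Proof.
move=> /eq_in_map gh.
have ghE (i : posnat) : (val i <= n)%N -> g i = h i.
  move=> le_in; rewrite -(pos_pred i); apply: gh.
  by rewrite mem_iota /= add0n prednK ?(valP i).
by move=> i j le_in le_jn; rewrite /relabel !ghE.
Qed.

Definition itinerary (I : finType) (P : X -> I) (F : {fset G}) (x : X) :
  {ffun F -> I} := [ffun g : F => P (relabel (fsval g) x)].

(** Let Q approximate P, and let the correction D x be None where Q is right and
    Some (P x) elsewhere. The itineraries of Q and D determine that of P. The
    former costs ln (m + 1) for each restriction of an element of F to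
    {1, ..., n}, the latter the entropy of D, at most e, for each element of
    F. *)
Lemma itinerary_entropy mu (m : nat) (P : borel X -> 'I_m) (e : R) :
  invariant_measure (@relabel R) mu -> measurable_fibers P -> 0 < e ->
  exists n, forall F : {fset G},
    entropy mu (itinerary P F : borel X -> _) <=
      ln m.+1%:R *+ size (undup [seq restriction n g | g <- F]) + e *+ #|` F|.
Proof.
move=> inv mP e0.
(* As s <= 1, the bound of entropy_heavy_cell for D, which has m + 1 values, is
   at most s c. *)
pose c : R := 1 + 2 *+ m.+1.
have c0 : 0 < c by rewrite ltr_pwDl.
pose s := Num.min 1 (e / c).
have s0 : 0 < s by rewrite lt_min ltr01 divr_gt0.
have s_le : s ^+ 2 + s *+ 2 *+ m.+1 <= e.
  apply: (@le_trans _ _ (s * c)).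
    rewrite mulrDr mulr1 -[s *+ 2]mulr_natr -mulrnAr lerD2r expr2.
    by rewrite ler_piMr ?(ltW s0)// ge_min lexx.
  by rewrite -ler_pdivlMr// ge_min lexx orbT.
have s20 : 0 < s ^+ 2 by rewrite exprn_gt0.
have [n [Q [nQ QP]]] := finite_partition_approximation mu mP s20.
have mQ := agree_measurable_fibers nQ.
pose corr (qp : option 'I_m * 'I_m) :=
  if qp.1 == Some qp.2 then None else Some qp.2.
pose D (x : borel X) := corr (Q x, P x).
have mD : measurable_fibers D.
  exact: measurable_fibers_comp (measurable_fibers_pair mQ mP).
have D_entropy : entropy mu D <= e.
  apply: le_trans s_le; have card_m : #|{: option 'I_m}| = m.+1.
    by rewrite card_option card_ord.
  rewrite -[in leRHS]card_m.
  apply: (entropy_heavy_cell (i0 := None)) => //; first exact: ltW.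
  rewrite (_ : [set x | D x != None] = [set x | Q x != Some (P x)])//.
  by apply/seteqP; split => x; rewrite /= /D /corr /=; case: ifP.
have PQD x y : Q x = Q y -> D x = D y -> P x = P y.
  rewrite /D /corr /= => <-; case: eqP => [Qx|nx]; case: eqP => [Qy|ny] //.
    by move: Qx; rewrite Qy => -[].
  by case.
exists n => F; set cs := undup _.
pose r (a : seq posnat) := xget (1%g : G) [set g | restriction n g = a].
have rP g : restriction n (r (restriction n g)) = restriction n g.
  exact: (@xgetI _ _ [set g' | restriction n g' = restriction n g] g erefl).
apply: entropy_bounded_entropy.
have hQ : entropy_bounded mu (fun x y => forall a, a \in cs ->
    Q (relabel (r a) x) = Q (relabel (r a) y)) (ln m.+1%:R *+ size cs).
  apply: entropy_bounded_all => a _.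
  exists (option 'I_m), (Q \o relabel (r a)); split => //.
    exact: relabel_measurable_fibers.
  apply: le_trans (entropy_le_ln_card _ _) _; first exact: relabel_measurable_fibers.
  by rewrite card_option card_ord.
have hD : entropy_bounded mu (fun x y => forall g, g \in enum_fset F ->
    D (relabel g x) = D (relabel g y)) (e *+ #|` F|).
  apply: entropy_bounded_all => g _.
  exists (option 'I_m), (D \o relabel g); split => //.
    exact: relabel_measurable_fibers.
  by rewrite relabel_entropy.
apply: entropy_bounded_sub (entropy_bounded_and hQ hD) => // x y [Qxy Dxy].
apply/ffunP => g; rewrite !ffunE; apply: PQD; last exact/Dxy/fsvalP.
set h := r (restriction n (fsval g)).
have hg z : Q (relabel (fsval g) z) = Q (relabel h z).
  by apply/nQ/restriction_agree; rewrite rP.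
rewrite !hg; apply: Qxy; rewrite mem_undup map_f//; exact: fsvalP.
Qed.

Lemma itinerary_cell (m : nat) (P : borel X -> 'I_m) (F : {fset G})
    (c : {ffun F -> 'I_m}) :
  join_cell (@relabel R) (fun i => P @^-1` [set i]) c =
  (itinerary P F : borel X -> _) @^-1` [set c].
Proof.
apply/seteqP; split => [x h|x /= <- g _ /=]; last by rewrite ffunE.
by apply/ffunP => g; rewrite ffunE; exact: (h g).
Qed.

Lemma itinerary_measurable_fibers (m : nat) (P : borel X -> 'I_m) (F : {fset G}) :
  measurable_fibers P -> measurable_fibers (itinerary P F : borel X -> _).
Proof.
move=> mP c; rewrite -itinerary_cell; apply: fin_bigcap_measurable => // g _.
by apply: relabel_measurable; exact: mP.
Qed.

(** With L the cost of one restriction and cs their number, the choice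
    M >= 4 L / e of the size of K makes L cs <= 2 L |F| / M <= (e / 2) |F|. *)
Lemma entropy_per_element_cvg0 mu (m : nat) (P : borel X -> 'I_m)
    (F : nat -> {fset G}) :
  invariant_measure (@relabel R) mu -> measurable_fibers P -> folner R F ->
  entropy mu (itinerary P (F n) : borel X -> _) / #|` F n|%:R @[n --> \oo]
    --> (0 : R).
Proof.
move=> inv mP FF; apply/cvgrPdist_le => e e0.
have e20 : 0 < e / 2 by rewrite divr_gt0.
have [n hn] := itinerary_entropy inv mP e20.
pose L : R := ln m.+1%:R.
have L0 : 0 <= L by rewrite ln_ge0// ler1n.
pose M := (Num.truncn (4 * L / e)).+1.
have hM : 4 * L <= e * M%:R.
  by rewrite [leRHS]mulrC -ler_pdivrMr// ltW// /M truncnS_gt.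
have [K cK hK] := large_pointwise_stabilizer n M.
have K0 : K != fset0 by rewrite -cardfs_gt0 cK.
have restrictionK h g : h \in K -> restriction n (h * g)%g = restriction n g.
  move=> hh; apply/eq_in_map => i; rewrite mem_iota add0n => /= lt_in.
  exact: (congr1 g (hK h hh (pos i) lt_in)).
have := folner_card_prod FF K0; apply: filterS => t ht.
have F0 : 0 < #|` F t|%:R :> R by rewrite ltr0n cardfs_gt0; case: FF.
set cs := size (undup [seq restriction n g | g <- F t]).
have hcs : (cs * M <= 2 * #|` F t|)%N.
  by apply: leq_trans ht; rewrite -cK; exact: card_classes_mul.
have M0 : 0 < M%:R :> R by rewrite ltr0n.
have Lcs : L *+ cs <= e / 2 * #|` F t|%:R.
  rewrite -(ler_pM2r M0) -[L *+ cs]mulr_natr -[leLHS]mulrA -natrM.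
  apply: (@le_trans _ _ (L * (2 * #|` F t|)%:R)); first by rewrite ler_wpM2l ?ler_nat.
  have -> : e / 2 * #|` F t|%:R * M%:R = e * M%:R / 2 * #|` F t|%:R :> R.
    by rewrite mulrAC; congr (_ * _); rewrite mulrAC.
  rewrite natrM mulrA ler_pM2r// ler_pdivlMr//; apply: le_trans hM.
  by rewrite -mulrA -natrM mulrC.
rewrite sub0r normrN ger0_norm; last first.
  by rewrite divr_ge0// entropy_ge0//; exact: itinerary_measurable_fibers.
rewrite ler_pdivrMr// [e]splitr mulrDl; apply: le_trans (hn _) _.
by rewrite lerD// mulr_natr.
Qed.

Lemma partition_entropy0 (F : nat -> {fset G}) mu (m : nat)
    (P : 'I_m -> set (borel X)) :
  folner R F -> invariant_measure (@relabel R) mu -> measurable_partition P ->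
  partition_entropy (@relabel R) F mu P = 0%E.
Proof.
move=> FF inv [[coverP trivP _] mP].
have /choice[f fP] (x : borel X) : exists i, P i x.
  have : cover [set: 'I_m] P x by rewrite coverP.
  by move=> [i _ Pix]; exists i.
have PE : P = (fun i => f @^-1` [set i]).
  apply/funext => i; apply/seteqP; split => [x Pix|x /= <-//].
  by apply: (trivP (f x) i) => //; exists x; split => //; exact: fP.
have mf : measurable_fibers f by move=> i; have := mP i; rewrite PE.
rewrite /partition_entropy PE.
rewrite (cvg_limn_einf_sup (l := 0%E) _).2//.
apply: (@cvg_trans _ ((entropy mu (itinerary f (F n) : borel X -> _) /
    #|` F n|%:R)%:E @[n --> \oo])); last first.
  by apply: cvg_EFin; [near=> n|exact: entropy_per_element_cvg0].
apply: near_eq_cvg; near=> n; congr (_ / _)%:E.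
rewrite /shannon_entropy /entropy; congr (- _); apply: eq_bigr => c _.
by rewrite itinerary_cell.
Unshelve. all: by end_near. Qed.

(** The empty relation is a fixed point, so its point mass is invariant. *)
Lemma dirac_invariant : invariant_measure (@relabel R)
  (\d_(point : borel X)).
Proof. by []. Qed.

Lemma trivial_partition : measurable_partition (fun _ : 'I_1 => [set: borel X]).
Proof.
split; last by move=> _; exact: measurableT.
split => //; last by move=> i _; exists point.
  by apply/seteqP; split => // x _; exists ord0.
by move=> i j _ _ _; rewrite !ord1.
Qed.

Lemma topological_entropy_relabel (F : nat -> {fset G}) : folner R F ->
  topological_entropy (@relabel R) F = 0%E.
Proof.
move=> FF.
have measure_entropy0 mu : invariant_measure (@relabel R) mu ->
    measure_entropy (@relabel R) F mu = 0%E.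
  move=> inv; rewrite /measure_entropy.
  rewrite (_ : [set _ | _] = [set 0%E]) ?ereal_sup1//.
  apply/seteqP; split => [_ [m [P [mP ->]]]|_ ->]; first exact: partition_entropy0.
  exists 1%N, (fun=> setT); split; first exact: trivial_partition.
  by rewrite partition_entropy0//; exact: trivial_partition.
rewrite /topological_entropy (_ : [set _ | _ in _] = [set 0%E]) ?ereal_sup1//.
apply/seteqP; split => [_ [mu inv <-]|_ ->]; first exact: measure_entropy0.
exists (\d_(point : borel X)); first exact: dirac_invariant.
exact/measure_entropy0/dirac_invariant.
Qed.

End ZeroEntropy.

Section MainTheorem.
Context (R : realType) (k : nat).
Local Notation X := (relation_space R).

Definition usual_order : X := fun i j => (val i < val j)%N.

Definition increasing_upto (x : X) : Prop :=
  forall i j : posnat, (val i < val j)%N -> (val j <= k)%N -> x i j.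

Lemma increasing_upto_continuous :
  continuous (fun x : X => `[< increasing_upto x >]%:R : R).
Proof.
move=> x U Ux; apply/nbhs_agree; exists k => y xy /=.
rewrite (_ : `[< increasing_upto y >] = `[< increasing_upto x >]); first exact: nbhs_singleton.
by apply/asboolP/asboolP => h i j ij jk;
  have := h i j ij jk; rewrite xy // ltnW// (leq_trans ij).
Qed.

Lemma C_incr_strongly_deterministic : strongly_deterministic R (C_incr k).
Proof.
exists X, (@relabel R), (fun x : X => `[< increasing_upto x >]%:R : R), usual_order.
split.
- exact: relabel_dynamical_system.
- exact: topological_entropy_relabel.
- exact: increasing_upto_continuous.
- by move=> g; rewrite indicE.
Qed.

End MainTheorem.

Theorem proposition7p2 (R : realType) (k : nat) (hk : (2 <= k)%N) :
  [/\ strongly_deterministic R (C_incr k),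
      has_banach_density (C_incr k) (k`!%:R^-1 : R) &
      0 < k`!%:R^-1 :> R].
Proof.
split; [exact: C_incr_strongly_deterministic|exact: C_incr_density|].
by rewrite invr_gt0 ltr0n fact_gt0.
Qed.
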